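(* Let $r, p_1, \dots, p_r$ be integers with $r\geq 2$ and $p_1\ge p_2\ge \dots \ge p_r\geq 2$, and let $s$ be the number of indices $i\in[r]$ such that $p_i$ is divisible by 3. Then the following hold: (1) $\displaystyle R^{PM}(p_1, \dots, p_r)\geq p_1-(r-1)+\sum_{i=2}^r\left\lceil\frac{p_i}{3}\right\rceil$; (2) $\displaystyle R^{PM}(p_1, \dots, p_r)\geq R^{1C}_s(3)+\sum_{i=1}^r\left(\left\lceil\frac{p_i}{3}\right\rceil-1\right)=\left\lfloor\frac{\sqrt{8s+1}+1}{2}\right\rfloor+1+\sum_{i=1}^r\left(\left\lceil\frac{p_i}{3}\right\rceil-1\right)$.
   Context: $[r]=\{1,\dots,r\}$. An $r$-coloring of $K_n$ is an assignment of a color from $[r]$ to each edge of the complete graph $K_n$ (not necessarily proper, and not every color need be used). The order of a graph is its number of vertices. A path-matching is a vertex-disjoint union of paths, each with at least 2 vertices; its order is the number of vertices it spans. A path-matching of color $i$ is a path-matching that is a subgraph of $K_n$ all of whose edges have color $i$. For positive integers $r,p_1,\dots,p_r$, $R^{PM}(p_1,\dots,p_r)$ is the smallest positive integer $n$ such that in every $r$-coloring of the edges of $K_n$ there exists a path-matching of color $i$ and order at least $p_i$ for some $i\in[r]$. A graph is a 1-core if it has minimum degree at least one (it need not be connected). A 1-core of color $i$ is a subgraph of $K_n$ that is a 1-core and all of whose edges have color $i$. $R^{1C}_s(3)$ is the smallest positive integer $n$ such that in every $s$-coloring of the edges of $K_n$ there exists a 1-core of color $i$ and order at least $3$ for some $i\in[s]$.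 (For $s=0$, this is read literally: $K_1$ has an empty coloring with no 1-core, while $K_2$ has no $0$-coloring, so $R^{1C}_0(3)=2$.) *)

(* Defs.v *)
From HB Require Import structures.
From mathcomp Require Import all_boot all_order all_algebra.
From mathcomp Require Import boolp reals.
Set Implicit Arguments.
Unset Strict Implicit.
Unset Printing Implicit Defensive.

(* K_n has vertex set 'I_n; its edges are the 2-element sets of vertices.
   An r-coloring of K_n is a function edge n -> 'I_r, with the color i of [r]
   encoded as i - 1 : 'I_r. In particular K_1 has exactly one 0-coloring and
   K_n has none for n >= 2. *)
Definition edge (n : nat) := {e : {set 'I_n} | #|e| == 2}.

Record subgraph (n : nat) := Subgraph {
  verts : {set 'I_n};
  edges : {set edge n};
  edges_verts : forall e, e \in edges -> val e \subset verts
}.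

Definition order n (G : subgraph n) : nat := #|verts G|.

Definition monochromatic n r (c : edge n -> 'I_r) (i : 'I_r) (G : subgraph n) :
  Prop := forall e, e \in edges G -> c e = i.

Definition path_edges n (q : seq 'I_n) : {set edge n} :=
  [set e : edge n |
    [exists x, exists y, infix [:: x; y] q && (val e == [set x; y])]].

(* Each path is given by its sequence of vertices; uniq (flatten ps) says both
   that no path repeats a vertex and that the paths are vertex-disjoint. *)
Definition is_path_matching n (G : subgraph n) : Prop :=
  exists ps : seq (seq 'I_n),
    [/\ uniq (flatten ps),
        all (fun q => 2 <= size q) ps,
        verts G = [set x in flatten ps]
      & edges G = \bigcup_(q <- ps) path_edges q].

Definition degree n (G : subgraph n) (x : 'I_n) : nat :=
  #|[set e in edges G | x \in val e]|.

Definition is_1core n (G : subgraph n) : Prop :=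
  forall x, x \in verts G -> 1 <= degree G x.

Definition forces (P : forall n, subgraph n -> Prop) r (p : 'I_r -> nat)
    (n : nat) : Prop :=
  forall c : edge n -> 'I_r, exists (i : 'I_r) (G : subgraph n),
    [/\ P n G, monochromatic c i G & p i <= order G].

(* The Ramsey numbers below exist: the matching {2j, 2j+1} of K_2m contains a
   large monochromatic submatching, by pigeonhole. *)
Section Existence.
Variables (m : nat).

Fact ltn_ev (j : 'I_m) : j.*2 < m.*2. Proof. by rewrite ltn_double. Qed.
Fact ltn_od (j : 'I_m) : j.*2.+1 < m.*2. Proof. by rewrite ltn_Sdouble. Qed.
Let ev (j : 'I_m) : 'I_m.*2 := Ordinal (ltn_ev j).
Let od (j : 'I_m) : 'I_m.*2 := Ordinal (ltn_od j).

Fact half_ev j : (ev j)./2 = j. Proof. exact: doubleK. Qed.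
Fact half_od j : (od j)./2 = j. Proof. exact: (half_bit_double j true). Qed.
Fact ev_neq_od j k : ev j != od k.
Proof.
apply/eqP => /(congr1 (fun x : 'I_m.*2 => odd x)) /=.
by rewrite !odd_double.
Qed.

Fact matching_edge_subproof j : #|[set ev j; od j]| == 2.
Proof. by rewrite cards2 ev_neq_od. Qed.
Definition matching_edge j : edge m.*2 :=
  exist (fun e : {set 'I_m.*2} => #|e| == 2) _ (matching_edge_subproof j).

Let M (J : seq 'I_m) := [seq [:: ev j; od j] | j <- J].

Fact mem_M J x : (x \in flatten (M J)) =
  has (fun j => (x == ev j) || (x == od j)) J.
Proof. by elim: J => //= j J IH; rewrite !inE IH orbA. Qed.

Fact uniq_M J : uniq J -> uniq (flatten (M J)).
Proof.
elim: J => //= j J IH /andP[jJ uJ]; rewrite IH // andbT inE negb_or ev_neq_od /=.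
rewrite !mem_M; apply/andP; split; apply/hasPn => k kJ; apply/norP;
  split; apply/eqP => /(congr1 (fun x : 'I_m.*2 => x./2));
  rewrite ?half_ev ?half_od => /val_inj jk; by rewrite jk kJ in jJ.
Qed.

Fact size_M J : size (flatten (M J)) = (size J).*2.
Proof. by elim: J => //= j J ->. Qed.

Fact path_edges2 j : path_edges [:: ev j; od j] = [set matching_edge j].
Proof.
apply/setP => e; rewrite !inE; apply/existsP/eqP.
  case=> x /existsP[y /andP[/infixP[s [t]] exy /eqP ve]]; apply: val_inj.
  rewrite ve /=; case: s exy => [|a s] /=; first by case=> -> ->.
  by case: s => [|b [|d s]].
move=> ->; exists (ev j); apply/existsP; exists (od j).
by rewrite eqxx infix_refl.
Qed.

Fact edges_M (J : seq 'I_m) (e : edge m.*2) :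
  (e \in \bigcup_(q <- M J) path_edges q) = has (fun j => e == matching_edge j) J.
Proof.
elim: J => [|j J IH] /=; first by rewrite big_nil inE.
by rewrite big_cons inE IH path_edges2 inE.
Qed.

Fact matching_verts (J : seq 'I_m) (e : edge m.*2) :
  e \in \bigcup_(q <- M J) path_edges q -> val e \subset [set x in flatten (M J)].
Proof.
rewrite edges_M => /hasP[j jJ /eqP->]; apply/subsetP => x; rewrite !inE mem_M.
by move=> xj; apply/hasP; exists j.
Qed.

Definition matching J : subgraph m.*2 := Subgraph (@matching_verts J).

Fact matching_path_matching J : uniq J -> is_path_matching (matching J).
Proof.
move=> uJ; exists (M J); split=> //; first exact: uniq_M.
by apply/allP => q /mapP[j _ ->].
Qed.

Fact matching_1core J : is_1core (matching J).
Proof.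
move=> x; rewrite inE mem_M => /hasP[j jJ xj].
rewrite /degree card_gt0; apply/set0Pn; exists (matching_edge j).
by rewrite inE edges_M !inE xj andbT; apply/hasP; exists j.
Qed.

Fact order_matching J : uniq J -> order (matching J) = (size J).*2.
Proof.
by move=> uJ; rewrite /order cardsE (card_uniqP (uniq_M uJ)) size_M.
Qed.

End Existence.

Lemma forces_ex (P : forall n, subgraph n -> Prop)
    (hP : forall m (J : seq 'I_m), uniq J -> P _ (matching J))
    r (p : 'I_r -> nat) :
  exists n, `[< 0 < n /\ forces P p n >].
Proof.
pose K := \max_i p i; pose m := (r * K).+1; exists m.*2; apply/asboolP.
split=> [|c]; first by rewrite double_gt0.
pose f j := c (@matching_edge m j).
have [i Ki] : exists i, K <= #|[pred j | f j == i]|.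
  apply/existsP; apply: contraT => /existsPn /= h.
  suff : m <= r * K by rewrite ltnn.
  rewrite -[X in X <= _]card_ord -sum1_card (partition_big f predT) //=.
  rewrite -[X in X * _]card_ord -sum_nat_const; apply: leq_sum => i _.
  by rewrite sum1_card ltnW // ltnNge h.
pose J := enum [pred j | f j == i].
exists i, (matching J); split.
- exact/hP/enum_uniq.
- move=> e; rewrite edges_M => /hasP[j].
  by rewrite mem_enum inE => /eqP fj /eqP ->.
- rewrite order_matching ?enum_uniq // -cardE.
  apply: leq_trans (leq_bigmax i) _.
  by apply: leq_trans Ki _; rewrite -addnn leq_addr.
Qed.

Lemma path_matching_ex r (p : 'I_r -> nat) :
  exists n, `[< 0 < n /\ forces is_path_matching p n >].
Proof. exact/forces_ex/matching_path_matching. Qed.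

Lemma one_core_ex s (k : nat) :
  exists n, `[< 0 < n /\ forces is_1core (fun _ : 'I_s => k) n >].
Proof. by apply: forces_ex => m J _; apply: matching_1core. Qed.

(* R^PM(p_1, ..., p_r) and R^1C_s(k): least n > 0 with the forcing property. *)
Definition RPM r (p : r.-tuple nat) : nat :=
  ex_minn (path_matching_ex (tnth p)).

Definition R1C (s k : nat) : nat := ex_minn (one_core_ex s k).

(* Main.v *)
Require Import Defs.
From mathcomp Require Import all_boot all_order all_algebra.
From mathcomp Require Import boolp reals.
From mathcomp Require Import zify lra.
Import Order.TTheory GRing.Theory Num.Theory.

(** In a path-matching every vertex lies on an edge and has at most two
    neighbours. Hence if all edges of color [i] meet a set [A] of vertices,
    except for some edges covering a set [B], then a path-matching of color [i]
    spans at most [3 #|A| + #|B|] vertices. Both lower bounds color a large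
    complete graph by giving the edges that meet a block [A_i] of
    [ceil (p_i / 3) - 1] vertices a color [i] whose block they meet. The
    remaining vertices form a clique, which in (1) has [p_1 - 1] vertices and
    only color [1] (with [A_1] empty), and in (2) has at most one edge of
    each color [i] with [3 %| p_i]. A 1-core of order at least 3 has two edges,
    and two edges form such a 1-core, so [R1C s 3] is the least [n > 0] with
    [s < 'C(n, 2)]. *)

(** * Order of a path-matching from a vertex cover of its edges *)

Lemma mem_bigcup_seq {T : finType} {I : Type} (s : seq I) (F : I -> {set T}) x :
  (x \in \bigcup_(i <- s) F i) = has (fun i => x \in F i) s.
Proof. by elim: s => [|i s IHs]; rewrite ?big_nil ?big_cons !inE ?IHs. Qed.

Lemma path_matching_edge {n} {G : subgraph n} {x : 'I_n} :
  is_path_matching G -> x \in verts G ->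
  exists2 e, e \in edges G & x \in val e.
Proof.
case=> ps [uniq_ps /allP size_ps -> ->]; rewrite inE => /flattenP[q q_ps xq].
have uniq_q : uniq q.
  have [s1 [s2 def_ps]] : exists s1 s2, ps = s1 ++ q :: s2.
    by case/splitPr: q_ps => s1 s2; exists s1, s2.
  move: uniq_ps; rewrite def_ps flatten_cat /= !cat_uniq.
  by case/and3P=> _ _ /andP[].
suff [z [t [zt_q xzt]]] : exists z t, infix [:: z; t] q /\ x \in [:: z; t].
  have zt : #|[set z; t]| == 2.
    by have:= infix_uniq zt_q uniq_q; rewrite /= inE andbT cards2 => ->.
  exists (exist (fun e : {set 'I_n} => #|e| == 2) _ zt); last first.
    by rewrite /= !inE in xzt *.
  rewrite mem_bigcup_seq; apply/hasP; exists q => //; rewrite inE.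
  by apply/existsP; exists z; apply/existsP; exists t; rewrite zt_q /=.
(* Pair [x] with its successor on [q], or with its predecessor if [x] comes last; the latter exists
   because [q] has at least two vertices. *)
have := size_ps _ q_ps; case/splitPr: xq => s1 [|y s2].
  case/lastP: s1 => [//|s1 y] _; exists y, x; rewrite !inE eqxx orbT.
  by split=> //; rewrite cat_rcons; apply/infixP; exists s1, [::].
move=> _; exists x, y; rewrite inE eqxx; split=> //.
by apply/infixP; exists s1, s2.
Qed.

(** [u] and [v] give the successor and predecessor in the concatenation of all paths. It has no
    repetition, so [index] recovers positions, and the ends of an edge are consecutive in it. Wrong
    values at the ends of paths do no harm. *)
Lemma path_matching_neighbors {n} {G : subgraph n} :
  is_path_matching G ->
  exists u v : 'I_n -> 'I_n, forall e x y, e \in edges G -> x \in val e ->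
    y \in val e -> y \in [:: x; u x; v x].
Proof.
case=> ps [uniq_ps _ _ ->]; set Q := flatten ps in uniq_ps.
exists (fun x => nth x Q (index x Q).+1), (fun x => nth x Q (index x Q).-1).
move=> e x y; rewrite mem_bigcup_seq => /hasP[q q_ps]; rewrite inE.
case/existsP=> z /existsP[t /andP[/infixP[s1 [s2 def_q]] /eqP->]].
have [S1 [S2 defQ]] : exists S1 S2, Q = S1 ++ [:: z, t & S2].
  rewrite /Q; case/splitPr: q_ps => l1 l2.
  exists (flatten l1 ++ s1), (s2 ++ flatten l2).
  by rewrite flatten_cat /= def_q /= -!catA.
have [zS1 tS1 tz] : [/\ z \notin S1, t \notin S1 & z != t].
  move: uniq_ps; rewrite defQ cat_uniq /= negb_or.
  case/and3P=> _ /andP[-> /norP[-> _]].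
  by rewrite inE negb_or => /andP[/andP[-> _] _].
have iz : index z Q = size S1.
  by rewrite defQ index_cat (negPf zS1) /= eqxx addn0.
have it : index t Q = (size S1).+1.
  by rewrite defQ index_cat (negPf tS1) /= eqxx (negPf tz) addn1.
rewrite !in_set2 !inE => /orP[] /eqP-> /orP[] /eqP->; rewrite ?eqxx //.
- by rewrite iz defQ nth_cat ltnNge leqnSn subSnn /= eqxx orbT.
- by rewrite it /= defQ [nth _ _ (size S1)]nth_cat ltnn subnn /= eqxx !orbT.
Qed.

(** A vertex outside [B] shares an edge with some [y] in [A], so it is [y], [u y] or [v y]. *)
Lemma path_matching_order {n} {G : subgraph n} (A B : {set 'I_n}) :
  is_path_matching G ->
  (forall e x, e \in edges G -> x \in val e ->
    x \in B \/ exists2 y, y \in A & y \in val e) ->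
  Defs.order G <= 3 * #|A| + #|B|.
Proof.
move=> pmG coverG; have [u [v uv]] := path_matching_neighbors pmG.
have: verts G \subset A :|: u @: A :|: v @: A :|: B.
  apply/subsetP=> x xG; have [e eG xe] := path_matching_edge pmG xG.
  have [xB|[y yA ye]] := coverG e x eG xe; first by rewrite !inE xB orbT.
  have:= uv e y x eG ye xe; rewrite !inE => /or3P[] /eqP->; first by rewrite yA.
    by rewrite imset_f ?orbT.
  by rewrite [v y \in v @: A]imset_f ?orbT.
move/subset_leq_card/leq_trans; apply.
apply: leq_trans (leq_of_leqif (leq_card_setU _ _)) _; rewrite leq_add2r.
apply: leq_trans (leq_of_leqif (leq_card_setU _ _)) _.
rewrite mulSnr leq_add ?leq_imset_card //.
apply: leq_trans (leq_of_leqif (leq_card_setU _ _)) _.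
by rewrite mul2n -addnn leq_add2l leq_imset_card.
Qed.

(** * The block coloring *)

Lemma not_forces_path_matching (N r m : nat) (p a : 'I_r -> nat)
    (c0 : {set 'I_N} -> 'I_r) :
  m <= N + \sum_i a i ->
  (forall i, 3 * a i + #|cover [set e in c0 @^-1: [set i] | #|e| == 2]|
    < p i) ->
  ~ forces is_path_matching p m.
Proof.
move=> le_m small_p.
(* The clique is the left summand; block vertices are tagged with their color. Embedding ['I_m] into
   [T] treats all smaller [m] at once. *)
pose T := ('I_N + {i : 'I_r & 'I_(a i)})%type.
have le_mT : m <= #|{: T}|.
  rewrite card_sum card_ord card_tagged sumnE big_map big_enum /=.
  apply: leq_trans le_m _; rewrite leq_add2l leq_sum // => i _.
  by rewrite card_ord.
pose f (x : 'I_m) : T := enum_val (widen_ord le_mT x).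
have f_inj : injective f.
  by move=> x y /enum_val_inj/(congr1 val) xy; apply: val_inj.
have inl_inj : injective (inl : 'I_N -> T) by move=> ? ? [].
pose A i := [set x : 'I_m | if f x is inr t then tag t == i else false].
pose base (e : {set 'I_m}) := [set y : 'I_N | inl y \in f @: e].
(* If [e] meets several blocks, any choice works: an edge of color [i] meets [A i] or avoids every
   block. *)
pose c (e : edge m) :=
  odflt (c0 (base (val e))) [pick i | ~~ [disjoint A i & val e]].
move=> /(_ c)[i [G [pmG monoG]]]; apply/negP; rewrite -ltnNge.
apply: leq_ltn_trans (small_p i).
pose B0 := cover [set e in c0 @^-1: [set i] | #|e| == 2].
pose B := [set x : 'I_m | if f x is inl y then y \in B0 else false].
have cardA : #|A i| <= a i.
  rewrite -(card_imset (A i) f_inj) -[leqRHS]card_ord.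
  have tag_inj : injective (fun k : 'I_(a i) => inr (Tagged _ k) : T).
    by move=> k l [] /eqP; rewrite eq_Tagged => /eqP.
  rewrite -(card_imset predT tag_inj).
  apply/subset_leq_card/subsetP=> _ /imsetP[x + ->]; rewrite inE.
  by case: (f x) => [//|[j k]] /= /eqP ji; subst j; apply: imset_f.
have cardB : #|B| <= #|B0|.
  rewrite -(card_imset B f_inj) -(card_imset B0 inl_inj).
  apply/subset_leq_card/subsetP=> _ /imsetP[x + ->]; rewrite inE.
  by case: (f x) => [y|//]; apply: imset_f.
apply: (leq_trans (path_matching_order (A i) B pmG _)); last first.
  by rewrite leq_add ?leq_mul.
move=> e x eG xe; have := monoG e eG; rewrite /c.
case: pickP => [j /= + ji | noA /= c0i].
  by rewrite {}ji => /pred0Pn[y /andP[yA ye]]; right; exists y.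
(* No block meets [e], so both ends lie in the clique and [base (val e)] is a 2-element set to which
   [c0] gives color [i]. *)
left; have fe y : y \in val e -> exists2 z, f y = inl z & z \in base (val e).
  move=> ye; case fy: (f y) => [z|t].
    by exists z; rewrite // inE -fy imset_f.
  have /negP[] := negbT (noA (tag t)).
  by apply/pred0Pn; exists y; rewrite /= ye inE fy eqxx.
have [z fx zbase] := fe x xe.
rewrite inE fx; apply/bigcupP; exists (base (val e)) => //.
rewrite !inE c0i eqxx /=.
have <- : #|val e| = #|base (val e)|; last exact: (valP e).
rewrite -(card_imset (mem (val e)) f_inj) -(card_imset (base (val e)) inl_inj).
apply/eq_card=> t; apply/imsetP/imsetP => -[y].
  by move=> ye ->; have [z' ? ?] := fe y ye; exists z'.
by rewrite inE => /imsetP[y' ? ->] ->; exists y'.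
Qed.

(** * 1-cores of order at least 3 *)

Lemma card_edge n : #|{: edge n}| = 'C(n, 2).
Proof. by rewrite card_sig -cardsE card_draws card_ord. Qed.

Lemma forces_1core_3 s n :
  forces is_1core (fun _ : 'I_s => 3) n <-> s < 'C(n, 2).
Proof.
split=> [|lt_sn c].
  rewrite -card_edge ltnNge => forces_n; apply/negP=> le_ns; move: forces_n.
  (* There are enough colors to make all edges different, so [G] has at most one edge and hence at
     most two vertices. *)
  move=> /(_ (fun e => widen_ord le_ns (enum_rank e)))[i [G [coreG monoG]]].
  have edgeG e1 e2 : e1 \in edges G -> e2 \in edges G -> e1 = e2.
    move=> /monoG c1 /monoG; rewrite -c1 => /(congr1 val)/= e21.
    by apply/enum_rank_inj/val_inj/esym.
  have edge_at x : x \in verts G -> exists2 e, e \in edges G & x \in val e.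
    by move=> /coreG/card_gt0P[e]; rewrite inE => /andP[]; exists e.
  apply/negP; rewrite -ltnNge ltnS /Defs.order.
  have [->|[x xG]] := set_0Vmem (verts G); first by rewrite cards0.
  have [e eG xe] := edge_at x xG.
  rewrite -(eqP (valP e)); apply/subset_leq_card/subsetP => y /edge_at[e' e'G].
  by rewrite (edgeG _ _ e'G eG).
have /injectivePn[e1 [e2 e12 c12]] : ~~ injectiveb c.
  apply: contraL lt_sn => /injectiveP/leq_card.
  by rewrite card_edge card_ord leqNgt.
have sub12 e : e \in [set e1; e2] -> val e \subset val e1 :|: val e2.
  by rewrite !inE => /orP[] /eqP->; rewrite ?subsetUl ?subsetUr.
exists (c e1), (Subgraph sub12); split=> /=.
- move=> x; rewrite !inE => x12; apply/card_gt0P.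
  by case/orP: x12 => xe; [exists e1 | exists e2]; rewrite !inE eqxx ?orbT xe.
- by move=> e; rewrite !inE => /orP[] /eqP->.
- rewrite /Defs.order /= ltnNge; apply: contra e12 => le2.
  (* A union with only two vertices would equal both edges. *)
  have eqU e : e \in [set e1; e2] -> val e = val e1 :|: val e2.
    by move=> /sub12 sub; apply/eqP; rewrite eqEcard sub (eqP (valP e)).
  apply/eqP/val_inj; apply: etrans (eqU e1 _) (esym (eqU e2 _));
    by rewrite !inE eqxx ?orbT.
Qed.

Lemma R1C_3 s :
  exists N, [/\ 0 < N, R1C s 3 = N.+1 & 'C(N, 2) <= s < 'C(N.+1, 2)].
Proof.
rewrite /R1C; case: ex_minnP => -[|[|N]] /asboolP[] // _.
  by move=> /forces_1core_3; rewrite bin_small.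
move=> /forces_1core_3 lt_s min_N; exists N.+1; split=> //; rewrite lt_s andbT.
rewrite leqNgt; apply/negP=> /forces_1core_3 forcesN.
by have := min_N N.+1 (asboolT (conj isT forcesN)); rewrite ltnn.
Qed.

(** * Both lower bounds over the natural numbers *)

Lemma ltn_RPM (N r : nat) (p : r.-tuple nat) (a : 'I_r -> nat)
    (c0 : {set 'I_N} -> 'I_r) :
  (forall i, 3 * a i + #|cover [set e in c0 @^-1: [set i] | #|e| == 2]|
    < tnth p i) ->
  N + \sum_i a i < RPM p.
Proof.
move=> small_p; rewrite /RPM; case: ex_minnP => m /asboolP[_ forces_m] _.
rewrite ltnNge; apply/negP=> le_m.
exact: not_forces_path_matching le_m small_p forces_m.
Qed.

Lemma RPM_ge_first (r : nat) (p : r.-tuple nat) :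
  0 < r -> (forall i, 0 < tnth p i) ->
  nth 0 p 0 + \sum_(1 <= i < r) (nth 0 p i).-1 %/ 3 <= RPM p.
Proof.
case: r p => // r p _ p_gt0.
(* For positive [k], [k.-1 %/ 3] is the ceiling of [k / 3] minus 1, the largest [a] with
   [3 * a < k]. *)
pose a (i : 'I_r.+1) := if i == ord0 then 0 else (tnth p i).-1 %/ 3.
have p0 : 0 < nth 0 p 0 by rewrite -(tnth_nth 0 p ord0) p_gt0.
have -> : \sum_(1 <= i < r.+1) (nth 0 p i).-1 %/ 3 = \sum_i a i.
  rewrite big_add1 big_mkord big_ord_recl /=.
  by apply: eq_bigr => i _; rewrite /a (tnth_nth 0).
rewrite -(prednK p0) addSn.
apply: (@ltn_RPM _ _ _ _ (fun _ => ord0)) => i.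
rewrite /a; case: eqVneq => [-> | i0].
  rewrite muln0 add0n (tnth_nth 0) /= -[ltnRHS](prednK p0) ltnS.
  by rewrite -[leqRHS]card_ord max_card.
rewrite [[set _ in _ | _]](_ : _ = set0) ?/cover ?big_set0 ?cards0 ?addn0.
  by have := p_gt0 i; lia.
by apply/setP => e; rewrite !inE eq_sym (negPf i0).
Qed.

Lemma RPM_ge_R1C (r : nat) (p : r.-tuple nat) :
  0 < r -> (forall i, 0 < tnth p i) ->
  R1C #|[set i : 'I_r | 3 %| tnth p i]| 3 + \sum_i (tnth p i).-1 %/ 3 <= RPM p.
Proof.
move=> r_gt0 p_gt0; set D := [set i | _].
have [N [_ -> /andP[le_ND _]]] := R1C_3 #|D|.
pose E := [set e : {set 'I_N} | #|e| == 2].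
have le_ED : #|E| <= #|D| by rewrite card_draws card_ord.
(* The clique edges get distinct colors from [D], which suffice since ['C(N, 2) <= #|D|]. Edges
   never reach the default. *)
pose c0 (e : {set 'I_N}) := nth (Ordinal r_gt0) (enum D) (index e (enum E)).
have lt_index e : e \in E -> index e (enum E) < #|D|.
  by move=> eE; apply: leq_trans le_ED; rewrite cardE index_mem mem_enum.
have c0D e : e \in E -> c0 e \in D.
  by move=> /lt_index; rewrite cardE => lt_e; rewrite -mem_enum mem_nth.
have c0_inj : {in E &, injective c0}.
  move=> e e' eE e'E /eqP; rewrite nth_uniq ?enum_uniq -?cardE ?lt_index //.
  move=> /eqP/(congr1 (nth e (enum E))).
  by rewrite !nth_index ?mem_enum.
rewrite addSn; apply: (@ltn_RPM _ _ _ _ c0) => i; have := p_gt0 i.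
set F := [set e in _ | _].
have FE e : e \in F -> e \in E /\ c0 e = i.
  by rewrite !inE => /andP[/eqP].
have [->|[e /FE[eE c0e]]] := set_0Vmem F.
  by rewrite /cover big_set0 cards0; lia.
have : #|cover F| <= 2.
  suff -> : F = [set e] by rewrite cover1; move: eE; rewrite inE => /eqP->.
  apply/setP=> e'; rewrite inE; apply/idP/eqP=> [/FE[e'E c0e']|->].
    by apply: c0_inj; rewrite ?c0e.
  by move: eE; rewrite !inE c0e eqxx.
(* Since 3 divides [tnth p i], the block uses [3 * a i = tnth p i - 3], which leaves room for the
   two ends of one edge. *)
have : i \in D by rewrite -c0e c0D.
by rewrite inE; lia.
Qed.

(** * Passage to real ceilings, roots and floors *)

Local Open Scope ring_scope.

(** With [q = k.-1 %/ d], one has [q * d < k <= (q + 1) * d]. *)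
Lemma ceil_divn (R : archiRealFieldType) (k d : nat) : (0 < k)%N -> (0 < d)%N ->
  Num.ceil (k%:R / d%:R : R) = (k.-1 %/ d)%:Z + 1.
Proof.
move=> k_gt0 d_gt0; apply: ceil_def.
have d_gt0R : (0 : R) < d%:R by rewrite ltr0n.
rewrite addrK -PoszD addn1 -!pmulrn ltr_pdivlMr // ler_pdivrMr //.
rewrite -!natrM ltr_nat ler_nat.
by have := ltn_ceil k.-1 d_gt0; have := leq_divM k.-1 d; lia.
Qed.

(** The binomial bounds put [8 * s + 1] between [(2 * N - 1) ^ 2] and, strictly,
    [(2 * N + 1) ^ 2]. *)
Lemma floor_root_bin2 (R : realType) (s N : nat) : (0 < N)%N ->
  ('C(N, 2) <= s < 'C(N.+1, 2))%N ->
  Num.floor ((Num.sqrt (8%:R * s%:R + 1) + 1) / 2%:R : R) = N.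
Proof.
case: N => // M _ /andP[]; have bin2M n : (2 * 'C(n.+1, 2) = n.+1 * n)%N.
  by rewrite -(mul_bin_diag n.+1 1) bin1.
rewrite -(leq_pmul2l (ltn0Sn 1)) bin2M => leM.
rewrite -(leq_pmul2l (ltn0Sn 1)) bin2M => ltM.
set x := Num.sqrt _; have x_ge0 : 0 <= x by apply: sqrtr_ge0.
have xx : x ^+ 2 = 8%:R * s%:R + 1 by rewrite sqr_sqrtr // addr_ge0 // mulr_ge0.
have {}leM : (M%:R + 1) * M%:R <= 2 * s%:R :> R.
  by rewrite natr1 -!natrM ler_nat.
have {}ltM : 2 * (s%:R + 1) <= (M%:R + 2) * (M%:R + 1) :> R.
  by rewrite !natr1 -natrD addn2 -!natrM ler_nat.
have M_ge0 : 0 <= M%:R :> R by [].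
apply: floor_def; rewrite -PoszD addn1 -!pmulrn.
rewrite -[M.+2]addn2 -[M.+1]addn1 !natrD.
by apply/andP; split; nra.
Qed.

Theorem corollary3p5 (R : realType) (r : nat) (p : r.-tuple nat)
    (hr : (2 <= r)%N)
    (hsort : forall i j : 'I_r, (i <= j)%N -> (tnth p j <= tnth p i)%N)
    (hp : forall i : 'I_r, (2 <= tnth p i)%N)
    (s : nat) (hs : s = #|[set i : 'I_r | (3 %| tnth p i)%N]|) :
  ((RPM p)%:Z >=
     (nth 0%N p 0)%:Z - (r%:Z - 1)
     + \sum_(1 <= i < r) Num.ceil ((nth 0%N p i)%:R / 3%:R : R))
  /\
  ((RPM p)%:Z >=
     (R1C s 3)%:Z + \sum_(i < r) (Num.ceil ((tnth p i)%:R / 3%:R : R) - 1)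
   /\
   (R1C s 3)%:Z + \sum_(i < r) (Num.ceil ((tnth p i)%:R / 3%:R : R) - 1)
   = Num.floor ((Num.sqrt (8%:R * s%:R + 1) + 1) / 2%:R : R) + 1
     + \sum_(i < r) (Num.ceil ((tnth p i)%:R / 3%:R : R) - 1)).
Proof.
have r_gt0 : (0 < r)%N by apply: leq_trans hr.
have p_gt0 i : (0 < tnth p i)%N by apply: leq_trans (hp i).
split; last split.
- have : Posz (nth 0 p 0 + \sum_(1 <= i < r) (nth 0 p i).-1 %/ 3)%N <= RPM p.
    by rewrite lez_nat RPM_ge_first.
  apply: le_trans.
  rewrite PoszD -(intz (\sum_(_ <= _ < _) _)%N) sumMz.
  under eq_big_nat => i /andP[_ ltir].
    have := p_gt0 (Ordinal ltir); rewrite (tnth_nth 0%N) /= => p_i.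
    rewrite ceil_divn // -[Posz _]intz.
    over.
  (* The [+ 1] from each of the [r - 1] ceilings cancels the term [- (r - 1)]. *)
  rewrite big_split /= sumr_const_nat natz -subzn //.
  by rewrite addrACA addNr addr0.
- rewrite (eq_bigr (fun i => ((tnth p i).-1 %/ 3)%N%:~R)); last first.
    by move=> i _; rewrite ceil_divn // addrK intz.
  by rewrite -sumMz intz -PoszD lez_nat hs RPM_ge_R1C.
- have [N [N_gt0 -> /(floor_root_bin2 R s N N_gt0) ->]] := R1C_3 s.
  by rewrite intS [1 + _]addrC.
Qed.
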